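(* For preferences $\pi\in\Pi_n=\{L,R\}^n$ of $n$ people around a circular table: (i) If $\pi$ is regular, there is a unique stable matching. (ii) If $\pi$ is irregular and $n$ is even, a matching is stable if and only if no person is unmatched. (iii) If $\pi$ is irregular and $n$ is odd, there exists no stable matching.
   Context: Consider $n$ people seated around a circular table, labeled $0,1,\dots,n-1$, with arithmetic on labels modulo $n$. Person $i$ has two neighbors: $i-1$ (left neighbor) and $i+1$ (right neighbor). A matching is a function $\mu:\{0,\dots,n-1\}\to\{0,\dots,n-1\}$ such that $\mu(i)\in\{i-1,i,i+1\}$ for all $i$, and $\mu(i)=j$ implies $\mu(j)=i$. Person $i$ is unmatched in $\mu$ if $\mu(i)=i$. Each person strictly prefers their left or their right neighbor, and prefers both neighbors to being alone. Preferences are thus represented by a string $\pi\in\Pi_n:=\{L,R\}^n$, whose $i$-th character (indexed from $0$) is the preference of person $i$: $L$ if $i$ prefers $i-1$, and $R$ if $i$ prefers $i+1$. Given preferences $\pi$, a matching $\mu$ is stable if and only if there is no blocking pair, i.e. no two neighbors $i$ and $i+1$ that are not currently matched to each other ($\mu(i)\ne i+1$) and that both prefer each other over their current match (or lack of match). A string $\pi$ is regular if it contains at least one $L$ and at least one $R$, and irregular otherwise (that is, if it contains only $L$'s or only $R$'s). *)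

(* Defs.v *)
From mathcomp Require Import all_boot.

Set Implicit Arguments.
Unset Strict Implicit.
Unset Printing Implicit Defensive.

Inductive side : Type := L | R.

Definition prefs (n : nat) : Type := {ffun 'I_n -> side}.

Section RoundTable.
Variable n : nat.
Implicit Types (pi : prefs n) (mu : {ffun 'I_n -> 'I_n}) (i j k : 'I_n).

(* The cyclic predecessor [ord_pred i] is i - 1 mod n and the cyclic successor
   [ordS i] is i + 1 mod n. *)
Definition neighbor i j : Prop := j = ord_pred i \/ j = ordS i.

Definition favorite pi i : 'I_n :=
  match pi i with L => ord_pred i | R => ordS i end.

(* Person i strictly prefers j to k; the value i itself stands for being alone.
   The ranking is: favorite neighbor, then other neighbor, then alone. Stated in
   this way it remains a strict order for n = 2, where both neighbors
   coincide. *)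
Definition prefers pi i j k : Prop :=
  (j = favorite pi i /\ k <> favorite pi i) \/ (neighbor i j /\ k = i).

Definition matching mu : Prop :=
  (forall i, mu i = ord_pred i \/ mu i = i \/ mu i = ordS i) /\
  (forall i j, mu i = j -> mu j = i).

Definition unmatched mu i : Prop := mu i = i.

Definition blocking pi mu i : Prop :=
  mu i <> ordS i /\
  prefers pi i (ordS i) (mu i) /\
  prefers pi (ordS i) i (mu (ordS i)).

Definition stable pi mu : Prop := forall i, ~ blocking pi mu i.

Definition regular pi : Prop := (exists i, pi i = L) /\ (exists i, pi i = R).

Definition irregular pi : Prop := ~ regular pi.

End RoundTable.

(* Main.v *)
Require Import Defs.
From mathcomp Require Import all_boot.

Set Implicit Arguments.
Unset Strict Implicit.
Unset Printing Implicit Defensive.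

(** Write f i for the favorite neighbor of i. If pi is regular, every f-orbit
    ends in a pair of mutual favorites. In a stable matching such a pair is
    matched, and i outside such a pair gets f i exactly when f i does not get
    f (f i); so whether i gets f i is the parity of the distance from i to the
    pair. The remaining people can only be matched to their second choice, which
    happens unless the latter is matched elsewhere.
    If pi is irregular, everyone is the favorite of a neighbor, who would block
    with them if they were alone; and a matching leaving nobody alone is a
    fixed-point-free involution, so that n is even. *)

(** Without fixed points, [mu] would map the set of [i] with [i < mu i] bijectively onto its
    complement, so [n] would be even. *)
Lemma odd_card_involution_fix (n : nat) (mu : 'I_n -> 'I_n) :
  involutive mu -> odd n -> exists i, mu i = i.
Proof.
move=> muK odd_n; have [/existsP[i /eqP]|] := boolP [exists i, mu i == i].
  by exists i.
rewrite negb_exists => /forallP mu_neq.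
pose A := [set i : 'I_n | i < mu i].
have imA : mu @: A = ~: A.
  apply/setP=> i; rewrite -{1}[i]muK mem_imset; last exact: can_inj muK.
  by rewrite !inE muK -leqNgt [RHS]leq_eqVlt (inj_eq val_inj) (negbTE (mu_neq i)).
have := cardsC A; rewrite -imA card_imset; last exact: can_inj muK.
by rewrite card_ord addnn => def_n; rewrite -def_n odd_double in odd_n.
Qed.

Lemma val_iter_ordS (n k : nat) (i : 'I_n) :
  iter k (@ordS n) i = (i + k) %% n :> nat.
Proof.
elim: k => [|k IHk] /=; first by rewrite addn0 modn_small.
by rewrite IHk -addn1 modnDml addn1 addnS.
Qed.

Lemma iter_ordS_onto (n : nat) (i j : 'I_n) : exists k, iter k (@ordS n) i = j.
Proof.
(* From [i], [n - i] steps lead to 0 and [j] more lead to [j]. *)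
exists (n - i + j); apply: val_inj; rewrite /= val_iter_ordS addnA subnKC.
  by rewrite modnDl modn_small.
exact: ltnW.
Qed.

Lemma iter_ord_pred_onto (n : nat) (i j : 'I_n) :
  exists k, iter k (@ord_pred n) i = j.
Proof.
have [k <-] := iter_ordS_onto j i; exists k.
by elim: k => // k IHk; rewrite iterSr iterS ordSK.
Qed.

(** * Favorites and second choices *)

Section RoundTable.
Variables (n : nat) (hn : 1 < n) (pi : prefs n).
Implicit Types (mu : {ffun 'I_n -> 'I_n}) (i j : 'I_n).

Local Notation f := (favorite pi).

(** For [n = 2] this is again the favorite. *)
Definition second_choice i : 'I_n :=
  match pi i with L => ordS i | R => ord_pred i end.
Local Notation o := second_choice.

Lemma ordS_neq i : ordS i != i.
Proof.
rewrite -(inj_eq val_inj) /=; have := ltn_ord i; rewrite leq_eqVlt.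
case/orP=> [/eqP def_n|lt_i]; last by rewrite modn_small // neq_ltn ltnSn orbT.
by rewrite {1}def_n modnn eq_sym -lt0n -ltnS def_n.
Qed.

Lemma ord_pred_neq i : ord_pred i != i.
Proof. by rewrite -{2}[i]ord_predK eq_sym ordS_neq. Qed.

Lemma favorite_neq i : f i != i.
Proof. by rewrite /favorite; case: (pi i); rewrite (ordS_neq, ord_pred_neq). Qed.

Lemma neighborC i j : neighbor i j -> neighbor j i.
Proof. by case=> ->; [right; rewrite ord_predK | left; rewrite ordSK]. Qed.

Lemma neighborP i j : neighbor i j <-> j = f i \/ j = o i.
Proof. by rewrite /neighbor /favorite /o; case: (pi i); tauto. Qed.

Lemma neighbor_favorite i : neighbor i (f i).
Proof. by apply/neighborP; left. Qed.

Lemma neighbor_second i : neighbor i (o i).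
Proof. by apply/neighborP; right. Qed.

Lemma second_neighbor i j : neighbor j i -> f i <> j -> o i = j.
Proof. by move/neighborC/neighborP=> [->|->]. Qed.

Lemma prefers_favorite i k : k <> f i -> prefers pi i (f i) k.
Proof. by left. Qed.

Lemma prefers_alone i j : neighbor i j -> prefers pi i j i.
Proof. by right. Qed.

Lemma matchingP mu :
  matching mu <->
    (forall i, mu i = i \/ neighbor i (mu i)) /\ involutive mu.
Proof.
split=> -[nb inv]; split.
- by move=> i; rewrite /neighbor; have := nb i; tauto.
- by move=> i; apply: inv.
- by move=> i; have := nb i; rewrite /neighbor; tauto.
- by move=> i _ <-; apply: inv.
Qed.

(** [blocking] is indexed by the left member of a pair; this form serves both orientations. *)
Lemma stable_neighbor mu i j : matching mu -> stable pi mu -> neighbor i j ->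
  prefers pi i j (mu i) -> prefers pi j i (mu j) -> mu i = j.
Proof.
move=> [_ inv] st nb pi_i pi_j; apply/eqP/negPn/negP => /eqP mu_ij.
case: nb => def_j; last by apply: (st i); rewrite /blocking -def_j.
have def_i : i = ordS j by rewrite def_j ord_predK.
by apply: (st j); rewrite /blocking -def_i; split=> // /inv.
Qed.

(** The orbit moves left as long as it meets [L]; the last [L] and the first [R] are mutual
    favorites. *)
Lemma favorite_orbit_from_L m i :
  pi i = L -> pi (iter m (@ord_pred n) i) = R ->
  exists k, f (f (iter k f i)) == iter k f i.
Proof.
elim: m i => [|m IHm] i piL; first by rewrite /= piL.
have fi : f i = ord_pred i by rewrite /favorite piL.
rewrite iterSr; case pi_pred: (pi (ord_pred i)) => pi_iter.
  by have [k] := IHm _ pi_pred pi_iter; exists k.+1; rewrite iterSr fi.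
by exists 0; rewrite /= fi /favorite pi_pred ord_predK.
Qed.

Lemma favorite_orbit_from_R m i :
  pi i = R -> pi (iter m (@ordS n) i) = L ->
  exists k, f (f (iter k f i)) == iter k f i.
Proof.
elim: m i => [|m IHm] i piR; first by rewrite /= piR.
have fi : f i = ordS i by rewrite /favorite piR.
rewrite iterSr; case pi_succ: (pi (ordS i)) => pi_iter.
  by exists 0; rewrite /= fi /favorite pi_succ ordSK.
by have [k] := IHm _ pi_succ pi_iter; exists k.+1; rewrite iterSr fi.
Qed.

Lemma favorite_orbit_mutual i :
  regular pi -> exists k, f (f (iter k f i)) == iter k f i.
Proof.
move=> [[l piL] [r piR]]; case pi_i: (pi i).
  have [m def_r] := iter_ord_pred_onto i r.
  by apply: (@favorite_orbit_from_L m); rewrite ?def_r.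
have [m def_l] := iter_ordS_onto i l.
by apply: (@favorite_orbit_from_R m); rewrite ?def_l.
Qed.

(** [d i] is the least number of steps from [i] to a member of a mutual pair. *)
Lemma mutual_distance : regular pi ->
  exists d : 'I_n -> nat,
    forall i, d i = if f (f i) == i then 0 else (d (f i)).+1.
Proof.
move=> reg; exists (fun i => ex_minn (favorite_orbit_mutual i reg)) => i.
case: ex_minnP => a mut_a min_a; case: ifP => [mut_i|not_mut].
  by apply/eqP; rewrite -leqn0 min_a.
case: ex_minnP => b mut_b min_b; apply/eqP; rewrite eqn_leq min_a ?iterSr //=.
(* As [i] is not in a mutual pair, [a] is positive, and its predecessor is a candidate for [f i]. *)
case: a mut_a {min_a} => [|a]; first by rewrite /= not_mut.
by rewrite iterSr => /min_b.
Qed.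

(** * Regular preferences: the parity matching *)

Section Regular.
Variable d : 'I_n -> nat.
Hypothesis d_rec : forall i, d i = if f (f i) == i then 0 else (d (f i)).+1.

Definition gets_favorite i := ~~ odd (d i).
Local Notation g := gets_favorite.

(** Someone without their favorite is paired with [o i] if [o i] favors them (and then gets them),
    or if [o i] lacks its favorite too. *)
Definition parity_matching : {ffun 'I_n -> 'I_n} :=
  [ffun i => if g i then f i
             else if (f (o i) == i) || ~~ g (o i) then o i else i].

Lemma gets_favorite_mutual i : f (f i) = i -> g i.
Proof. by move/eqP=> ffi; rewrite /g d_rec ffi. Qed.

Lemma gets_favorite_next i : f (f i) <> i -> g i = ~~ g (f i).
Proof. by move/eqP/negbTE=> ffi; rewrite /g d_rec ffi. Qed.

Lemma gets_favorite_pred i j : ~~ g i -> f j = i -> g j.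
Proof.
move=> gi fj; have [/eqP ffj|/eqP ffj] := boolP (f (f j) == j).
  exact: gets_favorite_mutual.
by rewrite gets_favorite_next // fj.
Qed.

Lemma matching_parity : matching parity_matching.
Proof.
apply/matchingP; split=> i.
  rewrite ffunE; case: ifP => _; first by right; apply: neighbor_favorite.
  by case: ifP => _; [right; apply: neighbor_second | left].
rewrite [parity_matching i]ffunE; case: ifPn => [gi|gi].
  rewrite ffunE; have [ffi|/eqP ffi] := eqVneq (f (f i)) i.
    by rewrite gets_favorite_mutual // ffi.
  (* Here [f i] lacks its favorite and has second choice [i], who favors it: the first disjunct
     applies. *)
  rewrite gets_favorite_next // in gi; rewrite (negbTE gi).
  by rewrite (second_neighbor _ ffi) ?eqxx //; apply: neighbor_favorite.
case: ifPn => [|out]; last by rewrite ffunE (negbTE gi) (negbTE out).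
rewrite ffunE; have [foi _|/eqP foi /= go] := eqVneq (f (o i)) i.
  by rewrite (gets_favorite_pred gi foi).
rewrite (negbTE go) (second_neighbor _ foi) ?gi ?orbT //.
exact: neighbor_second.
Qed.

Lemma prefers_parity i j : neighbor i j -> parity_matching i <> j ->
  prefers pi i j (parity_matching i) ->
  ~~ g i /\ (f i = j \/ o i = j /\ parity_matching i = i).
Proof.
move=> /neighborP nb; rewrite ffunE; case: ifPn => [gi ne|gi ne].
  case=> [[->]|[_]] //= /eqP; by rewrite (negbTE (favorite_neq i)).
case=> [[-> _]|[_ alone]]; first by split=> //; left.
by split=> //; case: nb => ->; [left | right].
Qed.

(** Both members of a blocking pair would lack their favorites, so by [gets_favorite_pred] neither
    favors the other. They are then mutual second choices, whom [parity_matching] pairs. *)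
Lemma stable_parity : stable pi parity_matching.
Proof.
have [_ inv] := matching_parity.
move=> i [ne [pref_i pref_j]]; set j := ordS i in ne pref_i pref_j.
have nb : neighbor i j by right.
have ne' : parity_matching j <> i by move/inv.
have [gi fav_i] := prefers_parity nb ne pref_i.
have [gj fav_j] := prefers_parity (neighborC nb) ne' pref_j.
case: fav_i => [fi|[oi alone]]; first by rewrite (gets_favorite_pred gj fi) in gi.
case: fav_j => [fj|_]; first by rewrite (gets_favorite_pred gi fj) in gj.
by apply: ne; rewrite ffunE (negbTE gi) oi gj orbT.
Qed.

(** Induction on [d i], since [f i] is one step closer to a mutual pair. *)
Lemma stable_gets_favorite mu i :
  matching mu -> stable pi mu -> (mu i == f i) = g i.
Proof.
move=> m st; have /matchingP[nb muK] := m.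
have [N] := ubnP (d i); elim: N i => // N IHN i lt_d.
have nbi := neighbor_favorite i; have nbj := neighborC nbi.
have [ffi|/eqP ffi] := eqVneq (f (f i)) i.
  rewrite gets_favorite_mutual //; apply/negPn/negP=> /eqP mui; apply: (mui).
  apply: stable_neighbor nbi _ _ => //; first exact: prefers_favorite.
  rewrite -{2}ffi; apply: prefers_favorite; rewrite ffi => muj.
  by apply: mui; rewrite -[in LHS]muj muK.
rewrite gets_favorite_next // -IHN; last first.
  by move: lt_d; rewrite d_rec (introF eqP ffi).
apply/eqP/idP => [mui|muj]; first by rewrite -mui muK mui; apply/eqP/nesym.
apply/eqP/negPn/negP=> /eqP mui; apply: (mui).
apply: stable_neighbor nbi _ _ => //; first exact: prefers_favorite.
(* Without its favorite, [f i] is alone and would accept [i], or is with its second choice, which is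
   [i]. *)
have [-> | /neighborP[mufi|muo]] := nb (f i).
- exact: prefers_alone.
- by rewrite mufi eqxx in muj.
by case: mui; rewrite -[RHS]muK muo (second_neighbor (neighbor_favorite i) ffi).
Qed.

Lemma stable_eq_parity mu : matching mu -> stable pi mu -> mu = parity_matching.
Proof.
move=> m st; have /matchingP[nb muK] := m.
have gE j := stable_gets_favorite j m st.
apply/ffunP=> i; rewrite ffunE; case: ifPn => [|gi].
  by rewrite -gE => /eqP.
have alone_or_second j : ~~ g j -> mu j = j \/ mu j = o j.
  by rewrite -gE => /eqP muj; have [|/neighborP[]] := nb j; tauto.
have [foi|/eqP foi] /= := eqVneq (f (o i)) i.
  have /eqP muoi : mu (o i) == i by rewrite -{2}foi gE (gets_favorite_pred gi foi).
  by rewrite -[in LHS]muoi muK.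
have ooi : o (o i) = i by exact: second_neighbor (neighbor_second i) foi.
(* Now [i] and [o i] are mutual second choices. If [o i] has its favorite, [i] stays alone; if not,
   the two would block when both alone. *)
case: ifPn => [go|]; last first.
  rewrite negbK -gE => /eqP muoi; have [//|mui] := alone_or_second i gi.
  by case: foi; rewrite -muoi -mui muK.
have [mui|//] := alone_or_second i gi.
have [muoi|] := alone_or_second _ go; last first.
  by rewrite ooi => muoi; rewrite -[in LHS]muoi muK.
apply: stable_neighbor => //; first exact: neighbor_second.
  by rewrite mui; apply/prefers_alone/neighbor_second.
by rewrite muoi; apply/prefers_alone/neighborC/neighbor_second.
Qed.

End Regular.

(** * Irregular preferences *)

Section Irregular.
Hypothesis irrpi : irregular pi.

(** All preferences point the same way, so the person on the less preferred side of [i] looks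
    towards [i]. *)
Lemma favorite_second i : f (o i) = i.
Proof.
rewrite /favorite /o; case pi_i: (pi i);
  [case pi_j: (pi (ordS i)) | case pi_j: (pi (ord_pred i))].
- exact: ordSK.
- by case: irrpi; split; [exists i | exists (ordS i)].
- by case: irrpi; split; [exists (ord_pred i) | exists i].
- exact: ord_predK.
Qed.

Lemma irregular_stable_perfect mu i : matching mu -> stable pi mu -> mu i <> i.
Proof.
move=> m st mui; have /matchingP[_ muK] := m.
have oi_neq : o i <> i by have := favorite_neq (o i); rewrite favorite_second => /eqP/nesym.
apply: oi_neq; rewrite -[RHS]mui; apply/esym.
apply: stable_neighbor => //; first exact: neighbor_second.
  by rewrite mui; apply/prefers_alone/neighbor_second.
rewrite -{2}(favorite_second i); apply: prefers_favorite.
rewrite favorite_second => muoi; have := favorite_neq (o i).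
by rewrite favorite_second -[o i]muK muoi mui eqxx.
Qed.

Lemma perfect_stable mu : matching mu -> (forall i, mu i <> i) -> stable pi mu.
Proof.
move=> m alone i [ne [pref_i pref_j]]; have /matchingP[nb _] := m.
case: pref_i => [[fi _]|[_ /alone //]]; case: pref_j => [[fj _]|[_ /alone //]].
(* With nobody alone, a blocking pair consists of mutual favorites. As [f] inverts [o], both choices
   of [ordS i] are then [i] (the case [n = 2]), so the two are already matched. *)
have oj : o (ordS i) = i by rewrite fi; apply: (canF_sym favorite_second).
have /matchingP[_ muK] := m; apply: ne; rewrite -[RHS]muK; congr (mu _).
have [/alone //|/neighborP[->|->]] := nb (ordS i); last by rewrite oj.
exact: fj.
Qed.

End Irregular.
End RoundTable.

Theorem proposition4 (n : nat) (hn : 1 < n) (pi : prefs n) :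
  (regular pi ->
     exists! mu : {ffun 'I_n -> 'I_n}, matching mu /\ stable pi mu) /\
  (irregular pi -> ~~ odd n ->
     forall mu : {ffun 'I_n -> 'I_n}, matching mu ->
       (stable pi mu <-> ~ exists i : 'I_n, unmatched mu i)) /\
  (irregular pi -> odd n ->
     ~ exists mu : {ffun 'I_n -> 'I_n}, matching mu /\ stable pi mu).
Proof.
split=> [reg|]; last split=> [irr _ mu m|irr odd_n [mu [m st]]].
- have [d d_rec] := mutual_distance reg; exists (parity_matching pi d).
  split=> [|mu [m st]]; last exact/esym/stable_eq_parity.
  by split; [apply: matching_parity | apply: stable_parity].
- split=> [st [i mui]|nobody]; first exact: (irregular_stable_perfect hn irr m st mui).
  by apply: (perfect_stable irr m) => i mui; apply: nobody; exists i.
have /matchingP[_ muK] := m; have [i mui] := odd_card_involution_fix muK odd_n.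
exact: (irregular_stable_perfect hn irr m st mui).
Qed.
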